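(* Let $\alpha>0$, $\beta>0$ and $|\xi|>1$; put $\varepsilon=1$ if $\xi<-1$ and $\varepsilon=-1$ if $\xi>1$. Let $c_0$ be the linear functional associated to the measure $|x-\xi|(1-x)^{\alpha-1}(1+x)^{\beta-1}dx$ on $]-1,1[$, and $c_1$ the one associated to $(1-x)^{\alpha}(1+x)^{\beta}dx$ on $]-1,1[$. For every $n\ge1$, $$c_1((p')^2)\le\frac1{\mu_{1,n}}\,c_0(p^2)\qquad\text{for all }p\in\mathcal P_n,$$ where $\mu_{1,n}$ is the smallest zero of the polynomial $A_n(\lambda)$ satisfying the three term recurrence relation $$A_n(\lambda)=(\lambda+B_n)A_{n-1}(\lambda)-C_nA_{n-2}(\lambda),\quad n\ge2,$$ with $$B_n=\frac{\varepsilon}{n(n+\alpha+\beta-1)}\Big(\xi-\frac{(\beta-\alpha)(\alpha+\beta-2)}{(2n+\alpha+\beta-2)(2n+\alpha+\beta)}\Big),$$ $$C_n=\frac{4(n+\alpha-1)(n+\beta-1)}{(n-1)(n+\alpha+\beta-1)(2n+\alpha+\beta-1)(2n+\alpha+\beta-2)^2(2n+\alpha+\beta-3)},$$ $A_0(\lambda)=1$ and $$\begin{aligned}A_1(\lambda)&=\lambda+\frac{\varepsilon}{\alpha+\beta}\,\frac{P_2^{(\alpha-1,\beta-1)}(\xi)}{P_1^{(\alpha-1,\beta-1)}(\xi)}\\&=\lambda+\frac{\varepsilon}{\alpha+\beta}\Big(\xi-\frac{(\beta-\alpha)(\alpha+\beta-2)}{(2+\alpha+\beta)(\alpha+\bet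a)}-\frac{4\alpha\beta}{(\alpha+\beta)_2(\xi(\alpha+\beta)-\beta+\alpha)}\Big)\\&=\lambda+\varepsilon\,\frac{(1+\alpha+\beta)_2\,\xi^2+2(\alpha-\beta)(1+\alpha+\beta)\xi+(\alpha-\beta)^2-(2+\alpha+\beta)}{(1+\alpha+\beta)_2\,(\xi(\alpha+\beta)-\beta+\alpha)}.\end{aligned}$$
   Context: $\mathcal P_n$ is the space of real polynomials in one variable of degree at most $n$. The linear functional associated to a measure $d\mu$ is $p\mapsto\int p\,d\mu$. $(a)_n=a(a+1)\cdots(a+n-1)$ is the Pochhammer symbol. $P_n^{(a,b)}$ ($a,b>-1$) is the monic Jacobi polynomial of degree $n$, orthogonal with respect to $(1-x)^a(1+x)^bdx$ on $]-1,1[$. The zeros of $A_n$ are real and positive. *)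

(* Defs.v *)
From HB Require Import structures.
From mathcomp Require Import all_boot all_order all_algebra.
From mathcomp Require Import all_classical all_reals all_analysis.

Set Implicit Arguments.
Unset Strict Implicit.
Unset Printing Implicit Defensive.

Import Order.TTheory GRing.Theory Num.Theory.

Local Open Scope classical_set_scope.
Local Open Scope ring_scope.

Section Definitions.
Variable R : realType.
Implicit Types (a b x xi alpha beta : R) (p q P : {poly R}).

Definition pochhammer a (n : nat) : R := \prod_(i < n) (a + i%:R).

Definition weight_functional (w : R -> R) p : R :=
  \int[lebesgue_measure]_(x in `]-1, 1[) (p.[x] * w x).

Definition jacobi_weight a b x : R := (1 - x) `^ a * (1 + x) `^ b.

Definition is_monic_jacobi a b (n : nat) P : Prop :=
  [/\ P \is monic, size P = n.+1 &
      forall q, (size q <= n)%N ->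
        weight_functional (jacobi_weight a b) (P * q) = 0].

(* Meaningful for a, b > -1, where the polynomial exists and is unique;
   the default value 0 is not monic. *)
Definition jacobi a b (n : nat) : {poly R} :=
  xget 0 [set P | is_monic_jacobi a b n P].

Definition c0 alpha beta xi p : R :=
  weight_functional
    (fun x => `|x - xi| * jacobi_weight (alpha - 1) (beta - 1) x) p.

Definition c1 alpha beta p : R :=
  weight_functional (jacobi_weight alpha beta) p.

(* Only used for |xi| > 1, so the second case is xi > 1. *)
Definition eps xi : R := if xi < -1 then 1 else -1.

Definition coefB alpha beta xi (n : nat) : R :=
  eps xi / (n%:R * (n%:R + alpha + beta - 1)) *
  (xi - (beta - alpha) * (alpha + beta - 2) /
        ((2 * n%:R + alpha + beta - 2) * (2 * n%:R + alpha + beta))).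

Definition coefC alpha beta (n : nat) : R :=
  4 * (n%:R + alpha - 1) * (n%:R + beta - 1) /
  ((n%:R - 1) * (n%:R + alpha + beta - 1) * (2 * n%:R + alpha + beta - 1) *
   (2 * n%:R + alpha + beta - 2) ^+ 2 * (2 * n%:R + alpha + beta - 3)).

Fixpoint polyA alpha beta xi (n : nat) {struct n} : {poly R} :=
  match n with
  | 0 => 1
  | S m =>
    match m with
    | 0 => 'X + (eps xi / (alpha + beta) *
                 ((jacobi (alpha - 1) (beta - 1) 2).[xi] /
                  (jacobi (alpha - 1) (beta - 1) 1).[xi]))%:P
    | S k => ('X + (coefB alpha beta xi n)%:P) * polyA alpha beta xi m
             - coefC alpha beta n *: polyA alpha beta xi k
    end
  end.

Definition is_smallest_zero p mu : Prop :=
  root p mu /\ forall nu : R, root p nu -> mu <= nu.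

End Definitions.

(* Main.v *)
Require Import Defs.
From HB Require Import structures.
From mathcomp Require Import all_boot all_order all_algebra.
From mathcomp Require Import all_classical all_reals all_analysis.
From mathcomp Require Import measurable_realfun polyrcf ring lra.

(** Let L be integration against w(x) = (1-x)^(alpha-1) (1+x)^(beta-1). Then
    c_0(p) = L(eps (x-xi) p) and c_1(p) = L((1-x^2) p). The monic Jacobi
    polynomials P_k are L-orthogonal and are eigenvectors of the Jacobi
    operator, so in the basis (P_k) the form p |-> c_1(p'^2) is diagonal and
    p |-> c_0(p^2) is tridiagonal. The pencil c_0(p^2) - lambda c_1(p'^2) thus
    has a Jacobi matrix, and A_n(lambda) is, up to a constant factor, its
    leading minor of order n+1: the Gram-Schmidt pivots of the pencil are
    positive multiples of - A_n(lambda) / A_{n-1}(lambda). By a Sturm argument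
    (-1)^k A_k is positive at mu_{1,n} for k < n, hence all pivots but the last
    are positive there and the last one vanishes. So the pencil is positive
    semidefinite at mu_{1,n}, and it is degenerate, which forces mu_{1,n} > 0
    because c_0 is positive definite. *)

Import Order.TTheory GRing.Theory Num.Theory.

Set Implicit Arguments.
Unset Strict Implicit.
Unset Printing Implicit Defensive.

Import numFieldNormedType.Exports.

Local Open Scope ring_scope.

(** * Integration against the Jacobi weight *)

Section JacobiWeight.
Local Open Scope classical_set_scope.
Variable R : realType.
Local Notation mu := (@lebesgue_measure R).
Implicit Types (a b c x : R) (p q u : {poly R}).

Lemma jacobi_weight_gt0 a b x : -1 < x < 1 -> 0 < jacobi_weight a b x.
Proof.
by move=> /andP[x1 x2]; rewrite mulr_gt0// powR_gt0//; lra.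
Qed.

Lemma jacobi_weightD1 a b x : -1 < x < 1 ->
  jacobi_weight a b x = (1 - x ^+ 2) * jacobi_weight (a - 1) (b - 1) x.
Proof.
move=> /andP[x1 x2]; have y0 : 1 - x != 0 by lra.
have z0 : 1 + x != 0 by lra.
rewrite /jacobi_weight !powRB ?y0 ?z0 ?implybT// !powRr1; try lra.
by field; rewrite y0 z0.
Qed.

Lemma is_derive_jacobi_weight a b x : -1 < x < 1 ->
  is_derive x 1 (jacobi_weight a b)
    ((b - a - (a + b) * x) * jacobi_weight (a - 1) (b - 1) x).
Proof.
move=> /andP[x1 x2].
have y0 : 0 < 1 - x by lra.
have z0 : 0 < 1 + x by lra.
have d1 := @is_derive1_comp _ (fun t : R => t `^ a) (cst 1 - id) x _ _
  (is_derive1_powR a y0)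
  (is_deriveB (is_derive_cst (1 : R^o) x (1 : R^o)) (is_derive_id x (1 : R^o))).
have d2 := @is_derive1_comp _ (fun t : R => t `^ b) (cst 1 + id) x _ _
  (is_derive1_powR b z0)
  (is_deriveD (is_derive_cst (1 : R^o) x (1 : R^o)) (is_derive_id x (1 : R^o))).
have H := is_deriveM d1 d2; apply: (trigger_derive H).
rewrite /GRing.scale/= /jacobi_weight !powRB ?lt0r_neq0 ?implybT//.
rewrite !powRr1 ?ltW//.
by field; rewrite !lt0r_neq0.
Qed.

Lemma derivable_poly_jacobi_weight a b p x : -1 < x < 1 ->
  derivable (fun t => p.[t] * jacobi_weight a b t) x 1.
Proof.
move=> x1; apply: derivableM; first exact: derivable_horner.
by have [] := is_derive_jacobi_weight a b x1.
Qed.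

Lemma jacobi_weight_within_continuous a b c p : c < 1 ->
  {within `[- c, c], continuous (fun x => p.[x] * jacobi_weight a b x)}.
Proof.
move=> c1; apply: derivable_within_continuous => x; rewrite in_itv/= => xc.
by apply: derivable_poly_jacobi_weight; lra.
Qed.

Lemma jacobi_weight_integrable_itv a b c p : c < 1 ->
  mu.-integrable `[- c, c] (EFin \o (fun x => p.[x] * jacobi_weight a b x)).
Proof.
move=> c1; apply: continuous_compact_integrable; first exact: segment_compact.
exact: jacobi_weight_within_continuous.
Qed.

(* Pearson's equation in divergence form: pearson a b q is the derivative of
   q (1-x)^a (1+x)^b divided by (1-x)^(a-1) (1+x)^(b-1). *)
Definition pearson a b q : {poly R} :=
  (1 - 'X^2) * q^`() + ((b - a)%:P - (a + b) *: 'X) * q.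

Lemma horner_pearson a b q x : (pearson a b q).[x] =
  (1 - x ^+ 2) * q^`().[x] + (b - a - (a + b) * x) * q.[x].
Proof. by rewrite /pearson !hornerE. Qed.

Lemma is_derive_pearson a b q x : -1 < x < 1 ->
  is_derive x 1 (fun t => q.[t] * jacobi_weight a b t)
    ((pearson a b q).[x] * jacobi_weight (a - 1) (b - 1) x).
Proof.
move=> x1.
have H := is_deriveM (is_derive_poly q x) (is_derive_jacobi_weight a b x1).
apply: (trigger_derive H).
rewrite /GRing.scale/= (jacobi_weightD1 a b x1) horner_pearson.
by ring.
Qed.

(** The weight may be singular at both ends of ]-1, 1[, so the fundamental theorem of calculus is
    applied on compact subintervals, and the ends are reached later by a limit. *)
Lemma Rintegral_pearson_itv a b c q : 0 < c < 1 ->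
  \int[mu]_(x in `[- c, c])
    ((pearson a b q).[x] * jacobi_weight (a - 1) (b - 1) x) =
  q.[c] * jacobi_weight a b c - q.[- c] * jacobi_weight a b (- c).
Proof.
move=> /andP[c0 c1]; rewrite /Rintegral.
pose G t := q.[t] * jacobi_weight a b t.
have cG : {within `[- c, c], continuous G}.
  exact: jacobi_weight_within_continuous.
have cc : - c < c by lra.
rewrite (@continuous_FTC2 _ _ G)//=.
- exact: jacobi_weight_within_continuous.
- split; last 2 first.
  + by have /(continuous_within_itvP _ cc)[] := cG.
  + by have /(continuous_within_itvP _ cc)[] := cG.
  move=> x; rewrite in_itv/= => xc; apply: derivable_poly_jacobi_weight; lra.
- move=> x; rewrite in_itv/= => xc.
  have x1 : -1 < x < 1 by lra.
  by rewrite derive1E; have [_ ->] := is_derive_pearson a b q x1.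
Qed.

Lemma jacobi_weight_le a b x : 0 <= a -> 0 <= b -> -1 < x < 1 ->
  jacobi_weight a b x <= 2 `^ a * 2 `^ b.
Proof.
move=> a0 b0 x1; rewrite ler_pM ?powR_ge0//.
  by rewrite ge0_ler_powR// ?nnegrE; lra.
by rewrite ge0_ler_powR// ?nnegrE; lra.
Qed.

(* With x0 = (b-a)/(a+b) and q = x0 - x, the polynomial
   pearson a b q + (1+a+b)(1-x^2) = (a+b)((x-x0)^2 + 1-x^2) is bounded below by
   a positive constant on [-1, 1], while its integral against the weight is a
   boundary term plus the integral of a bounded function. *)
Lemma Rintegral_jacobi_weight_itv_bounded a b : 0 < a -> 0 < b ->
  exists C, forall c, 0 < c < 1 ->
    \int[mu]_(x in `[- c, c]) jacobi_weight (a - 1) (b - 1) x <= C.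
Proof.
move=> a0 b0; pose s := a + b; pose x0 := (b - a) / s.
have s0 : 0 < s by rewrite /s; lra.
have sN0 : s != 0 by rewrite lt0r_neq0.
have x0s : x0 * s = b - a by rewrite /x0 divfK.
have x01 : `|x0| < 1.
  by rewrite ltr_norml; apply/andP; split; rewrite -(ltr_pM2r s0) x0s /s; lra.
pose M := 2 `^ a * 2 `^ b.
have M0 : 0 < M by rewrite mulr_gt0// powR_gt0.
(* The lower bound: $1 + x_0^2 - 2 x_0 x \ge (1 - |x_0|)^2$ on [-1, 1]. *)
pose d := s * (1 - `|x0|) ^+ 2.
have d0 : 0 < d by rewrite mulr_gt0// exprn_gt0// subr_gt0.
pose q : {poly R} := x0%:P - 'X.
(* Each of the two boundary values is at most 2 M, since [q] is bounded by 2; the bounded remainder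
   contributes at most (1 + s) M times the length 2. *)
exists ((4 + (1 + s) * 2) * M / d) => c c01.
have c1 : c < 1 by case/andP: c01.
set w := jacobi_weight (a - 1) (b - 1).
have iw p : mu.-integrable `[- c, c] (EFin \o (fun x => p.[x] * w x)).
  exact: jacobi_weight_integrable_itv.
have iwC r : mu.-integrable `[- c, c] (EFin \o (fun x => r * w x)).
  rewrite (_ : (fun x => r * w x) = fun x => r%:P.[x] * w x)//.
  by apply/funext => x; rewrite hornerC.
have mI : measurable `[- c, c] by exact: measurable_itv.
rewrite ler_pdivlMr// mulrC -RintegralZl//; last first.
  by have := iwC 1; under [X in EFin \o X]eq_fun do rewrite mul1r.
apply: (@le_trans _ _ (\int[mu]_(x in `[- c, c])
   ((pearson a b q + (1 + s) *: (1 - 'X^2)).[x] * w x))).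
  apply: le_Rintegral => //.
  move=> x; rewrite /= in_itv/= => xc.
  have x1 : -1 < x < 1 by lra.
  apply: ler_wpM2r; first exact/ltW/jacobi_weight_gt0.
  rewrite hornerD horner_pearson /q derivB derivC derivX sub0r hornerZ.
  rewrite !(hornerD, hornerN, hornerC, hornerX, hornerXn).
  have -> : (1 - x ^+ 2) * -1 + (b - a - (a + b) * x) * (x0 - x) +
      (1 + s) * (1 - x ^+ 2) = s * (1 + x0 ^+ 2 - 2 * (x0 * x)).
    by rewrite -x0s /s; ring.
  rewrite /d ler_pM2l// sqrrB expr1n mul1r real_normK ?num_real//.
  have : x0 * x <= `|x0|.
    by rewrite (le_trans (ler_norm _))// normrM ler_piMr// ler_norml; lra.
  lra.
under eq_Rintegral do rewrite hornerD mulrDl.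
rewrite RintegralD// Rintegral_pearson_itv//.
have G x : -1 < x < 1 -> `|q.[x] * jacobi_weight a b x| <= 2 * M.
  move=> x1; rewrite normrM ler_pM//.
    rewrite /q !hornerE (le_trans (ler_normB _ _))//.
    have : `|x| < 1 by rewrite ltr_norml.
    lra.
  by rewrite ger0_norm ?jacobi_weight_le ?ltW// jacobi_weight_gt0.
have -> : (4 + (1 + s) * 2) * M = 2 * M + 2 * M + (1 + s) * (M * 2) by ring.
rewrite lerD//.
  rewrite (le_trans (ler_norm _))// (le_trans (ler_normB _ _))//.
  by rewrite lerD// G//; lra.
have -> : \int[mu]_(x in `[- c, c]) (((1 + s) *: (1 - 'X^2)).[x] * w x) =
    \int[mu]_(x in `[- c, c]) ((1 + s) * jacobi_weight a b x).
  apply: eq_Rintegral => x; rewrite inE/= in_itv/= => xc.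
  rewrite (@jacobi_weightD1 a b); last by lra.
  by rewrite !hornerE.
have ij : mu.-integrable `[- c, c] (EFin \o (jacobi_weight a b)).
  rewrite (_ : jacobi_weight a b =
    fun x => (1 : {poly R}).[x] * jacobi_weight a b x).
    exact: jacobi_weight_integrable_itv.
  by apply/funext => x; rewrite hornerC mul1r.
rewrite RintegralZl// ler_pM2l; last by lra.
have iM : mu.-integrable `[- c, c] (EFin \o (fun=> M)).
  apply: continuous_compact_integrable; first exact: segment_compact.
  by apply: continuous_subspaceT => x; exact: cvg_cst.
apply: (@le_trans _ _ (\int[mu]_(x in `[- c, c]) M)).
  apply: le_Rintegral => // x; rewrite /= in_itv/= => xc.
  by rewrite jacobi_weight_le ?ltW//; lra.
rewrite Rintegral_cst// (_ : fine _ = c - - c).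
  by rewrite ler_pM2l//; lra.
rewrite [X in fine X](lebesgue_measure_itv `[- c, c]%R)/= lte_fin ifT//; lra.
Qed.

(** * Exhaustion of ]-1, 1[ by compact intervals *)

Definition cutoff (n : nat) : R := 1 - n.+2%:R^-1.

Lemma cutoff_itv n : 0 < cutoff n < 1.
Proof.
rewrite /cutoff subr_gt0 invf_lt1 ?ltr0n// ltr1n/=.
by rewrite ltrBlDr ltrDl invr_gt0 ltr0n.
Qed.

Lemma cvg_cutoff : cutoff n @[n --> \oo] --> (1 : R).
Proof.
rewrite -[X in _ --> X]subr0; apply: cvgB; first exact: cvg_cst.
by rewrite (cvg_shiftS (fun n => n.+1%:R^-1 : R)); exact: cvg_harmonic.
Qed.

Lemma cutoff_nondecreasing :
  nondecreasing_seq (fun n => `[- cutoff n, cutoff n]).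
Proof.
move=> n m nm; rewrite subsetEset.
have cnm : cutoff n <= cutoff m.
  by rewrite lerD2l lerN2 lef_pV2 ?posrE ?ltr0n// ler_nat.
by apply: subset_itvScc; rewrite bnd_simp ?lerN2.
Qed.

Lemma bigcup_cutoff : `]-1, 1[ = \bigcup_n `[- cutoff n, cutoff n].
Proof.
apply/seteqP; split => [x|x [n _]]; rewrite /= !in_itv/=; last first.
  by have := cutoff_itv n; lra.
move=> x1; have x0 : 0 < 1 - `|x| by rewrite subr_gt0 ltr_norml.
exists (Num.truncn (1 - `|x|)^-1) => //=.
rewrite in_itv/= -ler_norml lerBrDl -lerBrDr.
rewrite invf_ple ?posrE ?ltr0n// ltW// (lt_le_trans (truncnS_gt _))//.
by rewrite ler_nat.
Qed.

Lemma measurable_poly_jacobi_weight a b p :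
  measurable_fun `](-1 : R), 1[ (fun x => p.[x] * jacobi_weight a b x).
Proof.
apply: open_continuous_measurable_fun; first exact: interval_open.
move=> x; rewrite inE/= in_itv/= => x1.
apply: differentiable_continuous; apply/derivable1_diffP.
exact: derivable_poly_jacobi_weight.
Qed.

Lemma measurable_jacobi_weight a b :
  measurable_fun `](-1 : R), 1[ (jacobi_weight a b).
Proof.
rewrite (_ : jacobi_weight a b =
  fun x => (1 : {poly R}).[x] * jacobi_weight a b x).
  exact: measurable_poly_jacobi_weight.
by apply/funext => x; rewrite hornerC mul1r.
Qed.

(** Dominated convergence with bound $|f|$: at each point of ]-1, 1[ the restrictions of [f] to the
    compact intervals are eventually constant. *)
Lemma cvg_Rintegral_cutoff (f : R -> R) :
  mu.-integrable `](-1 : R), 1[ (EFin \o f) ->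
  \int[mu]_(x in `[- cutoff n, cutoff n]) f x @[n --> \oo] -->
  \int[mu]_(x in `]-1, 1[) f x.
Proof.
move=> fi; have mf := measurable_int _ fi.
have KI n : `[- cutoff n, cutoff n] `<=` `]-1, 1[.
  by move=> x Kx; rewrite bigcup_cutoff; exists n.
apply: fine_cvg; rewrite fineK; last exact: integrable_fin_num.
have -> : (fun n => \int[mu]_(x in `[(- cutoff n)%R, cutoff n]) (f x)%:E)%E =
    (fun n => \int[mu]_(x in `](-1)%R, 1%R[)
       ((EFin \o f) \_ `[(- cutoff n)%R, cutoff n]) x)%E.
  apply/funext => n; rewrite -integral_mkcondr; congr integral.
  by rewrite setIidr.
have dct := @dominated_cvg _ _ R mu `](-1)%R, 1%R[ _
  (fun n => (EFin \o f) \_ `[(- cutoff n)%R, cutoff n]) (EFin \o f)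
  (fun x => `|(EFin \o f) x|%E).
apply: dct => //.
- move=> n; apply/(measurable_restrict _ _ _).1 => //.
  by apply: measurable_funS mf => // x [].
- move=> x Ix; apply: cvg_near_cst.
  move: (Ix); rewrite bigcup_cutoff => -[n _ xn].
  near=> m; rewrite patchE mem_set//.
  have : (n <= m)%N by near: m; exact: nbhs_infty_ge.
  by move/cutoff_nondecreasing; rewrite subsetEset; exact.
- exact: integrable_abse.
- move=> n x Ix; rewrite patchE; case: ifPn => //.
  by rewrite abse0 abse_ge0.
Unshelve. all: by end_near. Qed.

Lemma cvg_harmonicS_powR a : 0 < a ->
  (n.+2%:R^-1 : R) `^ a @[n --> \oo] --> (0 : R).
Proof.
move=> a0; move/cvg_at_rightP : (powR_cvg0 (R := R) a0); apply.
split; first by move=> n; rewrite invr_gt0 ltr0n.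
by rewrite (cvg_shiftS (fun n => n.+1%:R^-1 : R)); exact: cvg_harmonic.
Qed.

(** As a > 0, the factor with exponent [a] tends to 0 at the end 1, while the other factors have
    finite limits. *)
Lemma cvg_jacobi_weight_cutoff a b q : 0 < a -> 0 < b ->
  (q.[cutoff n] * jacobi_weight a b (cutoff n)) @[n --> \oo] --> (0 : R).
Proof.
move=> a0 b0.
have qc : q.[cutoff n] @[n --> \oo] --> q.[1].
  exact: (cvg_comp _ _ cvg_cutoff (@continuous_horner R q 1)).
have bc : (1 + cutoff n) `^ b @[n --> \oo] --> (1 + 1 : R) `^ b.
  have c1 : (1 + cutoff n) @[n --> \oo] --> (1 + 1 : R).
    by apply: cvgD; [exact: cvg_cst|exact: cvg_cutoff].
  have c2 : {for (1 + 1 : R), continuous (fun t : R => t `^ b)}.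
    apply: differentiable_continuous; apply/derivable1_diffP.
    by apply: derivable_powR; rewrite in_itv/= andbT addr_gt0.
  exact: (cvg_comp _ _ c1 c2).
have ac : (1 - cutoff n) `^ a @[n --> \oo] --> (0 : R).
  have -> : (fun n => (1 - cutoff n) `^ a) = (fun n => (n.+2%:R^-1 : R) `^ a).
    by apply/funext => n; rewrite /cutoff subKr.
  exact: cvg_harmonicS_powR.
have -> : (0 : R) = q.[1] * (0 * (1 + 1) `^ b) by rewrite mul0r mulr0.
by apply: cvgM => //; apply: cvgM.
Qed.

Lemma jacobi_weightN a b x : jacobi_weight a b (- x) = jacobi_weight b a x.
Proof. by rewrite /jacobi_weight opprK mulrC. Qed.

(** * The functional L: integrability, Pearson's identity, positivity *)

Section Positive.
Variables (a b : R) (a0 : 0 < a) (b0 : 0 < b).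
Local Notation w := (jacobi_weight (a - 1) (b - 1)).

(** Monotone convergence: the integrals over the compact intervals increase and are uniformly
    bounded. *)
Lemma jacobi_weight_integrable : mu.-integrable `](-1 : R), 1[ (EFin \o w).
Proof.
apply/integrableP; split.
  by apply/measurable_EFinP; exact: measurable_jacobi_weight.
have [C HC] := Rintegral_jacobi_weight_itv_bounded a0 b0.
apply: (@le_lt_trans _ _ C%:E); last exact: ltry.
rewrite bigcup_cutoff.
have w0 n x : `[- cutoff n, cutoff n] x -> 0 <= w x.
  rewrite /= in_itv/= => xn; apply/ltW/jacobi_weight_gt0.
  by have := cutoff_itv n; lra.
have iw n : mu.-integrable `[- cutoff n, cutoff n] (EFin \o w).
  rewrite (_ : w = fun x => (1 : {poly R}).[x] * w x); last first.
    by apply/funext => x; rewrite hornerC mul1r.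
  by apply: jacobi_weight_integrable_itv; case/andP: (cutoff_itv n).
have H : (\int[mu]_(x in `[(- cutoff n)%R, cutoff n]) `|(EFin \o w) x|
      @[n --> \oo] -->
    \int[mu]_(x in \bigcup_n `[(- cutoff n)%R, cutoff n]) `|(EFin \o w) x|)%E.
  apply: ge0_nondecreasing_set_cvg_integral => //.
  - exact: cutoff_nondecreasing.
  - by move=> n; apply: measurableT_comp => //; exact: measurable_int (iw n).
rewrite -(cvg_lim _ H)//; apply: lime_le.
  by apply/cvg_ex; eexists; exact: H.
apply: nearW => n.
have -> : (\int[mu]_(x in `[(- cutoff n)%R, cutoff n]) `|(EFin \o w) x| =
   (\int[mu]_(x in `[(- cutoff n)%R, cutoff n]) w x)%:E)%E.
  rewrite fineK; last by apply: integrable_fin_num.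
  apply: eq_integral => x; rewrite inE/= => xn.
  by rewrite ger0_norm// (w0 n).
by rewrite lee_fin HC// cutoff_itv.
Qed.

(** A polynomial is bounded on [-1, 1], so the integrand is dominated by a multiple of [w]. *)
Lemma poly_jacobi_weight_integrable p :
  mu.-integrable `](-1 : R), 1[ (EFin \o (fun x => p.[x] * w x)).
Proof.
have [M HM] : exists M : R, forall x, -1 < x < 1 -> `|p.[x]| <= M.
  have /compact_bounded[M [_ HM]] :=
    continuous_compact (continuous_subspaceT (@continuous_horner R p))
      (@segment_compact R (-1) 1).
  exists (M + 1) => x x1; apply: (HM (M + 1)); first by rewrite ltrDl.
  by exists x => //=; rewrite in_itv/=; lra.
have M0 : 0 <= M by apply: le_trans (HM 0 _); rewrite ?normr_ge0//; lra.
have iMw : mu.-integrable `](-1 : R), 1[ (fun x => M%:E * (EFin \o w) x)%E.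
  by apply: integrableZl => //; exact: jacobi_weight_integrable.
apply: le_integrable iMw => //.
  by apply/measurable_EFinP; exact: measurable_poly_jacobi_weight.
move=> x; rewrite /= in_itv/= => x1; rewrite lee_fin !normrM ler_pM//.
by rewrite (ger0_norm M0) HM.
Qed.

Local Notation L := (weight_functional (jacobi_weight (a - 1) (b - 1))).

Lemma jacobi_functional_linear k p q : L (k *: p + q) = k * L p + L q.
Proof.
have i p := poly_jacobi_weight_integrable p.
rewrite /weight_functional -RintegralZl// -RintegralD//; last first.
  rewrite (_ : (fun x => _) = (fun x => (k *: p).[x] * w x))//.
  by apply/funext => x; rewrite hornerZ mulrA.
by apply: eq_Rintegral => x _; rewrite hornerD hornerZ mulrDl -mulrA.
Qed.

Lemma jacobi_functional_pearson q : L (pearson a b q) = 0.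
Proof.
have H := cvg_Rintegral_cutoff (poly_jacobi_weight_integrable (pearson a b q)).
have H1 := @cvg_jacobi_weight_cutoff a b q a0 b0.
(* The end -1 is sent to 1 by the reflection x -> -x, which swaps the exponents. *)
have H2 := @cvg_jacobi_weight_cutoff b a (q \Po - 'X) b0 a0.
have := cvgB H1 H2; rewrite subrr => H3.
rewrite /weight_functional -(cvg_lim _ H)//; apply/cvg_lim => //.
rewrite (_ : (fun n => _) = (fun n =>
   q.[cutoff n] * jacobi_weight a b (cutoff n) -
   (q \Po - 'X).[cutoff n] * jacobi_weight b a (cutoff n))); first exact: H3.
apply/funext => n; rewrite Rintegral_pearson_itv ?cutoff_itv//.
by rewrite -(jacobi_weightN a b) horner_comp hornerN hornerX.
Qed.

(** If the integral were 0, the integrand would vanish almost everywhere, and ]-1, 1[ would be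
    covered by a null set and the finitely many roots of [u]. *)
Lemma jacobi_functional_gt0 u : u != 0 ->
  (forall x, -1 < x < 1 -> 0 <= u.[x]) -> 0 < L u.
Proof.
move=> u0 uge0.
have iu := poly_jacobi_weight_integrable u.
have uw0 x : `](-1 : R), 1[ x -> 0 <= u.[x] * w x.
  rewrite /= in_itv/= => x1.
  by rewrite mulr_ge0 ?uge0// ltW// jacobi_weight_gt0.
rewrite lt_neqAle Rintegral_ge0// andbT eq_sym; apply/eqP => Lu0.
have : (\int[mu]_(x in `](-1)%R, 1%R[) `|(u.[x] * w x)%:E| = 0)%E.
  rewrite -[RHS]/(0%R%:E) -Lu0 fineK; last exact: integrable_fin_num.
  by apply: eq_integral => x; rewrite inE => Ix; rewrite gee0_abs// lee_fin uw0.
move/ae_eq_integral_abs => /(_ (measurable_itv _) (measurable_int _ iu)).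
case=> N [mN N0 subN].
have S0 : (mu [set` rootsR u] = 0)%E.
  apply: countable_lebesgue_measure0; exact/finite_set_countable/finite_seq.
have mS : measurable ([set` rootsR u] : set (measurableTypeR R)).
  exact/countable_measurable/finite_set_countable/finite_seq.
have IN : `](-1 : R), 1[ `<=` N `|` [set` rootsR u].
  move=> x Ix; have x1 : -1 < x < 1 by move: Ix; rewrite /= in_itv.
  have [ux0|ux0] := eqVneq u.[x] 0.
    by right; rewrite /= -roots_on_rootsR ?in_itv//=; apply/rootP.
  left; apply: subN => /= /(_ Ix) [] /eqP.
  by rewrite mulf_eq0 (negbTE ux0)/= gt_eqF//; exact: jacobi_weight_gt0.
have I0 : (mu `](-1)%R, 1%R[ <= 0)%E.
  rewrite -(null_set_setU mN mS N0 S0).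
  by apply: le_measure => //; rewrite inE//; apply: measurableU.
move: I0; rewrite [X in (X <= _)%E](lebesgue_measure_itv `](-1), 1[%R)/=.
by rewrite lte_fin ifT ?lee_fin; lra.
Qed.

End Positive.

End JacobiWeight.

(** * Orthogonal polynomials of a Pearson functional *)

Lemma size_sub_lead (R : nzRingType) (P q : {poly R}) n :
  P \is monic -> size P = n.+1 -> (size q <= n.+1)%N ->
  (size (q - q`_n *: P)%R <= n)%N.
Proof.
move=> /monicP mP sP sq; apply/leq_sizeP => j; rewrite leq_eqVlt coefB coefZ.
case/predU1P => [<-|nj]; last first.
  have Pj : P`_j = 0 by rewrite nth_default ?sP.
  by rewrite Pj mulr0 subr0 nth_default// (leq_trans sq nj).
by move: mP; rewrite /lead_coef sP => ->; rewrite mulr1 subrr.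
Qed.

Section OrthogonalPolynomials.
Variables (R : realType) (L : {poly R} -> R).
Hypothesis L_linear : forall k p q, L (k *: p + q) = k * L p + L q.
Hypothesis L_gt0 : forall u, u != 0 ->
  (forall x, -1 < x < 1 -> 0 <= u.[x]) -> 0 < L u.
Implicit Types (p q r P Q : {poly R}).

Lemma L_D p q : L (p + q) = L p + L q.
Proof. by have := L_linear 1 p q; rewrite scale1r mul1r. Qed.

Lemma L_0 : L 0 = 0.
Proof. by have := L_D 0 0; rewrite addr0; lra. Qed.

Lemma L_Z k p : L (k *: p) = k * L p.
Proof. by have := L_linear k p 0; rewrite L_0 !addr0. Qed.

Lemma L_B p q : L (p - q) = L p - L q.
Proof. by rewrite L_D -scaleN1r L_Z mulN1r. Qed.

Lemma L_sqr_gt0 p : p != 0 -> 0 < L (p ^+ 2).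
Proof.
move=> p0; apply: L_gt0; first by rewrite expf_neq0.
by move=> x _; rewrite horner_exp sqr_ge0.
Qed.

Lemma L_sqr_eq0 p : L (p ^+ 2) = 0 -> p = 0.
Proof.
by move=> Lp; apply/eqP; apply: contra_eqT Lp => /L_sqr_gt0 /lt0r_neq0.
Qed.

Definition monic_orthogonal n P :=
  [/\ P \is monic, size P = n.+1 &
      forall q, (size q <= n)%N -> L (P * q) = 0].

(** Gram-Schmidt. The induction hypothesis serves twice: on ['X^m], giving the new orthogonal
    direction [P], and on [p] itself; [k] is the coefficient of [p - r] along [P]. *)
Lemma exists_orthogonal_projection m p :
  exists r, (size r <= m)%N /\
    forall q, (size q <= m)%N -> L ((p - r) * q) = 0.
Proof.
elim: m p => [|m IH] p.
  exists 0; rewrite size_poly0; split=> // q.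
  by rewrite leqn0 size_poly_eq0 => /eqP ->; rewrite mulr0 L_0.
have [t [st ot]] := IH 'X^m; have [r [sr or]] := IH p.
pose P := 'X^m - t.
have sP : size P = m.+1 by rewrite size_polyDl size_polyXn// size_polyN ltnS.
have mP : P \is monic.
  by rewrite monicE lead_coefDl ?lead_coefXn// size_polyN size_polyXn ltnS.
have P0 : L (P ^+ 2) != 0 by rewrite lt0r_neq0// L_sqr_gt0// monic_neq0.
pose k := L ((p - r) * P) / L (P ^+ 2).
exists (r + k *: P); split.
  rewrite (leq_trans (size_polyD _ _))// geq_max (leq_trans sr)//=.
  by rewrite (leq_trans (size_scale_leq _ _))// sP.
move=> q sq; rewrite -(subrK (q`_m *: P) q) mulrDr L_D opprD addrA.
have sq' := size_sub_lead mP sP sq.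
rewrite mulrBl L_B or// -scalerAl L_Z ot// mulr0 subrr add0r.
rewrite -scalerAr L_Z mulrBl L_B -scalerAl L_Z -expr2 divfK// subrr.
by rewrite mulr0.
Qed.

Lemma exists_monic_orthogonal n : exists P, monic_orthogonal n P.
Proof.
have [t [st ot]] := exists_orthogonal_projection n 'X^n.
exists ('X^n - t); split=> //.
  by rewrite monicE lead_coefDl ?lead_coefXn// size_polyN size_polyXn ltnS.
by rewrite size_polyDl size_polyXn// size_polyN ltnS.
Qed.

Lemma monic_orthogonal_lead n P : monic_orthogonal n P -> P`_n = 1.
Proof. by case=> /monicP + sP _; rewrite /lead_coef sP. Qed.

Lemma L_monic_orthogonalM n P q : monic_orthogonal n P ->
  (size q <= n.+1)%N -> L (P * q) = q`_n * L (P ^+ 2).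
Proof.
move=> [mP sP oP] sq; rewrite -{1}(subrK (q`_n *: P) q) mulrDr L_D.
by rewrite oP ?size_sub_lead// add0r -scalerAr L_Z.
Qed.

(** * The Jacobi operator and the three term recurrence *)

Section Jacobi.
Variables (a b : R) (a0 : 0 < a) (b0 : 0 < b).
Hypothesis L_pearson : forall q, L (pearson a b q) = 0.

(** The classical $k(k+A+B+1)$ for the exponents $A = a-1$ and $B = b-1$. *)
Definition jacobi_eigenvalue (k : nat) : R := k%:R * (k%:R + a + b - 1).

Local Notation ev := jacobi_eigenvalue.

Lemma jacobi_eigenvalue_gt0 k : 0 < ev k.+1.
Proof.
have k0 : 0 <= k%:R :> R by exact: ler0n.
have h : 0 < k%:R + 1 + a + b - 1 by move: (a0) (b0); lra.
rewrite natr1 in h.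
by apply: mulr_gt0 h; rewrite ltr0n.
Qed.

(** The Jacobi differential operator $(1-x^2)p'' + (b-a-(a+b)x)p'$. *)
Definition jacobi_op p := pearson a b p^`().

Lemma coef_jacobi_op p k : (jacobi_op p)`_k =
  - ev k * p`_k + (b - a) * k.+1%:R * p`_k.+1 + (k.+2 * k.+1)%:R * p`_k.+2.
Proof.
have -> : jacobi_op p = p^`()^`() - 'X^2 * p^`()^`() +
    ((b - a)%:P * p^`() - (a + b)%:P * ('X * p^`())).
  by rewrite /jacobi_op /pearson -mul_polyC; ring.
rewrite !(coefD, coefN, coefXnM, coefCM, coefXM, coef_deriv) /jacobi_eigenvalue.
case: k => [|[|k]]; rewrite ?subn0 ?subSS ?subn0 /=.
- by ring.
- by ring.
- by rewrite !natrM; ring.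
Qed.

(** Integration by parts: Pearson's identity for the product $p' q$. *)
Lemma L_green p q : L ((1 - 'X^2) * (p^`() * q^`())) = - L (jacobi_op p * q).
Proof.
have := L_pearson (p^`() * q).
have -> : pearson a b (p^`() * q) =
    (1 - 'X^2) * (p^`() * q^`()) + jacobi_op p * q.
  by rewrite /jacobi_op /pearson derivM; ring.
by rewrite L_D; lra.
Qed.

(* jacobi_op is triangular in the monomials and symmetric for L, so
   jacobi_op P + ev k P has degree < k and is orthogonal to itself. *)
Lemma jacobi_op_eigen k P : monic_orthogonal k P -> jacobi_op P = - ev k *: P.
Proof.
move=> oP; have [mP sP orP] := oP.
apply/eqP; rewrite scaleNr -addr_eq0; apply/eqP; set r := _ + _.
have sJ q : (size (jacobi_op q) <= size q)%N.
  apply/leq_sizeP => j sj; rewrite coef_jacobi_op !nth_default ?mulr0 ?addr0//.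
    by rewrite (leq_trans sj)// leqW.
  exact: leq_trans sj _.
have sr : (size r <= k)%N.
  apply/leq_sizeP => j; rewrite coefD coefZ leq_eqVlt => /predU1P[<-|kj].
    rewrite coef_jacobi_op (monic_orthogonal_lead oP).
    by rewrite !(@nth_default _ _ _ _.+1) ?sP//; ring.
  by rewrite !nth_default ?mulr0 ?addr0// ?(leq_trans (sJ _)) ?sP.
have symJ p q : L (jacobi_op p * q) = L (p * jacobi_op q).
  by apply: oppr_inj; rewrite [p * _]mulrC -!L_green [q^`() * _]mulrC.
apply: L_sqr_eq0; rewrite expr2 {1}/r mulrDl L_D -scalerAl L_Z orP//.
by rewrite mulr0 addr0 symJ orP// (leq_trans (sJ _)).
Qed.

Variable P : nat -> {poly R}.
Hypothesis P_orthogonal : forall k, monic_orthogonal k (P k).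

Local Notation h k := (L (P k ^+ 2)).

Lemma h_gt0 k : 0 < h k.
Proof.
by apply: L_sqr_gt0 => //; case: (P_orthogonal k) => /monic_neq0.
Qed.

Lemma size_P k : size (P k) = k.+1.
Proof. by case: (P_orthogonal k). Qed.

Lemma P_lead k : (P k)`_k = 1.
Proof. exact: (monic_orthogonal_lead (P_orthogonal k)). Qed.

(** Comparing coefficients in the eigenvalue equation gives a descending recursion that starts at
    the leading 1. The two coefficients below it determine the three term recurrence. *)
Lemma eigen_coef k j : (ev k - ev j) * (P k)`_j =
  - ((b - a) * j.+1%:R * (P k)`_j.+1 + (j.+2 * j.+1)%:R * (P k)`_j.+2).
Proof.
have := jacobi_op_eigen (P_orthogonal k).
move/(congr1 (fun p : {poly R} => p`_j)).
by rewrite coef_jacobi_op coefZ => H; rewrite mulrBl; lra.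
Qed.

Lemma P_coef1 k : (P k.+1)`_k = - (b - a) * (k%:R + 1) / (2 * k%:R + a + b).
Proof.
have := eigen_coef k.+1 k; rewrite P_lead [_`_k.+2]nth_default ?size_P//.
rewrite mulr0 addr0 mulr1 /jacobi_eigenvalue -natr1.
have k0 : 0 <= k%:R :> R by exact: ler0n.
move: k%:R k0 => t t0.
(* The eigenvalue gap [ev k.+1 - ev k], with [t] for k. *)
have d0 : 0 < 2 * t + a + b by move: (a0) (b0); lra.
move=> H; apply: (mulIf (lt0r_neq0 d0)); rewrite divfK ?lt0r_neq0//.
by rewrite mulNr -H; ring.
Qed.

Lemma P_coef2 k : (P k.+2)`_k = - ((b - a) * (k%:R + 1) * (P k.+2)`_k.+1 +
   (k%:R + 2) * (k%:R + 1)) / (2 * (2 * k%:R + 1 + a + b)).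
Proof.
have := eigen_coef k.+2 k; rewrite P_lead mulr1 natrM /jacobi_eigenvalue.
rewrite -[k.+2%:R]natr1 -[k.+1%:R]natr1.
have k0 : 0 <= k%:R :> R by exact: ler0n.
move: k%:R k0 => t t0.
(* The eigenvalue gap [ev k.+2 - ev k]. *)
have d0 : 0 < 2 * (2 * t + 1 + a + b) by move: (a0) (b0); lra.
move=> H; apply: (mulIf (lt0r_neq0 d0)); rewrite divfK ?lt0r_neq0//.
by move: H; lra.
Qed.

(* rec_b and rec_c are the coefficients of the three term recurrence
   X P_k = P_{k+1} + rec_b k P_k + rec_c (k-1) P_{k-1}. *)
Definition rec_b k := (if k is j.+1 then (P k)`_j else 0) - (P k.+1)`_k.

Lemma size_XP k : size ('X * P k) = k.+2.
Proof. by rewrite mulrC size_mulX ?size_P// -size_poly_eq0 size_P. Qed.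

Lemma size_XP_sub k : (size ('X * P k - P k.+1)%R <= k.+1)%N.
Proof.
case: (P_orthogonal k.+1) => mP sP _.
have := size_sub_lead mP sP (q := 'X * P k).
by rewrite size_XP coefXM/= P_lead scale1r; apply.
Qed.

Lemma L_XP2 k : L ('X * P k ^+ 2) = rec_b k * h k.
Proof.
have -> : 'X * P k ^+ 2 = P k * ('X * P k - P k.+1) + P k.+1 * P k by ring.
rewrite L_D// (L_monic_orthogonalM (P_orthogonal k)) ?size_XP_sub//.
case: (P_orthogonal k.+1) => _ _ -> //; last by rewrite size_P.
by rewrite addr0 coefB coefXM /rec_b; case: k.
Qed.

Definition rec_c k : R := (if k is j.+1 then (P k.+1)`_j else 0)
  - (P k.+2)`_k - rec_b k.+1 * (P k.+1)`_k.

Lemma size_rec k :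
  (size ('X * P k.+1 - P k.+2 - rec_b k.+1 *: P k.+1)%R <= k.+1)%N.
Proof.
case: (P_orthogonal k.+1) => mP sP _.
have := size_sub_lead mP sP (size_XP_sub k.+1).
by rewrite coefB coefXM.
Qed.

(** The value of L at $x P_k P_{k+1}$ is computed twice: by the leading term of $x P_k$, and by
    expanding $x P_{k+1}$. *)
Lemma h_rec k : h k.+1 = rec_c k * h k.
Proof.
transitivity (L (P k.+1 * ('X * P k))).
  rewrite (L_monic_orthogonalM (P_orthogonal k.+1)) ?size_XP//.
  by rewrite coefXM P_lead mul1r.
have -> : P k.+1 * ('X * P k) =
  P k * ('X * P k.+1 - P k.+2 - rec_b k.+1 *: P k.+1) +
  (P k.+2 * P k + rec_b k.+1 *: (P k.+1 * P k)).
  by rewrite -!mul_polyC; ring.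
rewrite !L_D L_Z.
rewrite (L_monic_orthogonalM (P_orthogonal k)) ?size_rec//.
case: (P_orthogonal k.+1) => _ _ ->; last by rewrite size_P.
case: (P_orthogonal k.+2) => _ _ ->; last by rewrite size_P.
rewrite mulr0 !addr0 /rec_c !coefB coefZ coefXM.
by case: k.
Qed.

(** The index starts at 1 because at 0 the factor a + b - 2 of the denominator can vanish. *)
Lemma rec_bE k : rec_b k.+1 = (b - a) * (a + b - 2) /
  ((2 * k.+1%:R + a + b - 2) * (2 * k.+1%:R + a + b)).
Proof.
rewrite /rec_b !P_coef1 -[k.+1%:R]natr1.
have k0 : 0 <= k%:R :> R by exact: ler0n.
move: k%:R k0 => t t0; move: (a0) (b0) => a1 b1.
by field; do ?[apply/andP; split]; apply: lt0r_neq0; lra.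
Qed.

(** The first coefficient [rec_c 0] is left out: the denominator would contain a + b - 1, which can
    vanish. *)
Lemma rec_cE k : rec_c k.+1 = 4 * k.+2%:R * (k.+2%:R + a - 1) *
    (k.+2%:R + b - 1) * (k.+2%:R + a + b - 2) /
  ((2 * k.+2%:R + a + b - 1) * (2 * k.+2%:R + a + b - 2) ^+ 2 *
   (2 * k.+2%:R + a + b - 3)).
Proof.
rewrite /rec_c rec_bE !P_coef2 !P_coef1 -[k.+2%:R]natr1 -[k.+1%:R]natr1.
have k0 : 0 <= k%:R :> R by exact: ler0n.
move: k%:R k0 => t t0; move: (a0) (b0) => a1 b1.
by field; do ?[apply/andP; split]; apply: lt0r_neq0; lra.
Qed.

Variables (xi e lam : R).
Hypothesis e2 : e * e = 1.

(** * The pencil of quadratic forms *)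

(** The polar form of $c_0(p^2) - \lambda c_1(p'^2)$, with both functionals written through L and
    [e] in the role of the sign [eps xi]. *)
Definition pencil p q :=
  e * L (('X - xi%:P) * (p * q)) - lam * L ((1 - 'X^2) * (p^`() * q^`())).

Lemma pencilC p q : pencil p q = pencil q p.
Proof. by rewrite /pencil [p * _]mulrC [p^`() * _]mulrC. Qed.

Lemma pencil_subZl c p r q :
  pencil (p - c *: r) q = pencil p q - c * pencil r q.
Proof.
rewrite /pencil derivB derivZ.
have -> : ('X - xi%:P) * ((p - c *: r) * q) =
    (- c) *: (('X - xi%:P) * (r * q)) + ('X - xi%:P) * (p * q).
  by rewrite -!mul_polyC polyCN; ring.
have -> : (1 - 'X^2) * ((p^`() - c *: r^`()) * q^`()) =
    (- c) *: ((1 - 'X^2) * (r^`() * q^`())) + (1 - 'X^2) * (p^`() * q^`()).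
  by rewrite -!mul_polyC polyCN; ring.
by rewrite !L_linear; ring.
Qed.

Lemma pencil_jacobi k q : pencil (P k) q =
  e * (L (P k * ('X * q)) - xi * L (P k * q)) - lam * (ev k * L (P k * q)).
Proof.
rewrite /pencil L_green (jacobi_op_eigen (P_orthogonal k)) -scalerAl L_Z.
have -> : ('X - xi%:P) * (P k * q) = - xi *: (P k * q) + P k * ('X * q).
  by rewrite -!mul_polyC polyCN; ring.
by rewrite L_linear; ring.
Qed.

(** Tridiagonality: by the eigenvalue equation the derivative part is orthogonal to lower degrees,
    and multiplication by x raises the degree by one only. *)
Lemma pencil_jacobi_low k q : (size q <= k.+1)%N ->
  pencil (P k.+1) q = e * q`_k * h k.+1.
Proof.
move=> sq; rewrite pencil_jacobi.
have [_ _ oP] := P_orthogonal k.+1; rewrite (oP q sq).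
rewrite (L_monic_orthogonalM (P_orthogonal k.+1)); last first.
  by rewrite mulrC (leq_trans (size_polyMleq _ _))// size_polyX addn2.
by rewrite coefXM/=; ring.
Qed.

Lemma pencil_jacobi_diag k :
  pencil (P k) (P k) = (e * (rec_b k - xi) - lam * ev k) * h k.
Proof.
rewrite pencil_jacobi.
have -> : P k * ('X * P k) = 'X * P k ^+ 2 by ring.
by rewrite L_XP2 -expr2; ring.
Qed.

(** The values $A_k(\lambda)$, with $B_k$ and $C_k$ expressed through norms, eigenvalues and
    recurrence coefficients. The form of [A_1] makes the pivot recurrence hold at its first step. *)
Variable A : nat -> R.
Hypothesis A_0 : A 0%N = 1.
Hypothesis A_1 : A 1%N = lam + e / ev 1 * (xi - rec_b 1) +
  h 1 / (ev 1 * pencil (P 0) (P 0)).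
Hypothesis A_rec : forall k, A k.+2 =
  (lam + e / ev k.+2 * (xi - rec_b k.+2)) * A k.+1
  - h k.+2 / (h k.+1 * ev k.+2 * ev k.+1) * A k.

(** Closed form of the Gram-Schmidt pivots. Index 0 is separate because [ev 0] is 0, so that the
    first pivot does not depend on [lam]. *)
Definition pencil_pivot k := if k is j.+1 then - ev k * h k * A k / A j
  else pencil (P 0) (P 0).

Definition pencil_orthogonal n Q :=
  [/\ Q \is monic, size Q = n.+1 &
      forall q, (size q <= n)%N -> pencil Q q = 0].

(** Dividing the linear recurrence of [A] by its middle term gives the elimination recurrence of a
    tridiagonal matrix with off-diagonal entries [e * h k.+1]. *)
Lemma pencil_pivot_rec k : pencil_pivot k != 0 -> A k != 0 ->
  pencil_pivot k.+1 = pencil (P k.+1) (P k.+1) - h k.+1 ^+ 2 / pencil_pivot k.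
Proof.
have evn0 j : ev j.+1 != 0 by rewrite lt0r_neq0// jacobi_eigenvalue_gt0.
have hn0 j : h j != 0 by apply: lt0r_neq0; exact: h_gt0.
case: k => [|k] /= D0 Ak0; rewrite pencil_jacobi_diag.
  rewrite A_0 A_1; move: (pencil (P 0) (P 0)) D0 => D D0.
  by field; rewrite evn0 D0.
(* Division by 0 yields 0, so a nonzero pivot forces a nonzero denominator. *)
have Aj0 : A k != 0.
  by move: D0; apply: contra_neqN => /eqP ->; rewrite invr0 mulr0.
rewrite A_rec; field.
by rewrite Ak0 Aj0 !evn0 !hn0.
Qed.

(** By tridiagonality $P_{n+1}$ is already orthogonal to degrees below n, so only a multiple of [Q]
    is subtracted; as [Q] is monic, its pairing with $P_{n+1}$ is [e * h n.+1]. *)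
Lemma pencil_orthogonal_step n Q : pencil_orthogonal n Q -> pencil Q Q != 0 ->
  exists Q', pencil_orthogonal n.+1 Q' /\
    pencil Q' Q' = pencil (P n.+1) (P n.+1) - h n.+1 ^+ 2 / pencil Q Q.
Proof.
move=> [mQ sQ oQ] Q0; pose c := e * h n.+1 / pencil Q Q.
have [mP sP _] := P_orthogonal n.+1.
have Qn : Q`_n = 1 by move/monicP: mQ; rewrite /lead_coef sQ.
have scQ : (size (c *: Q) < size (P n.+1))%N.
  by rewrite sP ltnS (leq_trans (size_scale_leq _ _))// sQ.
have sQ' : size (P n.+1 - c *: Q) = n.+2.
  by rewrite size_polyDl ?size_polyN// sP.
have oQ' q : (size q <= n.+1)%N -> pencil (P n.+1 - c *: Q) q = 0.
  move=> sq; rewrite pencil_subZl pencil_jacobi_low//.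
  have -> : pencil Q q = q`_n * pencil Q Q.
    have := size_sub_lead mQ sQ sq => /oQ.
    by rewrite pencilC pencil_subZl pencilC => /eqP; rewrite subr_eq0 => /eqP.
  by rewrite /c; field.
exists (P n.+1 - c *: Q); split; first split=> //.
  by rewrite monicE lead_coefDl ?size_polyN// -monicE.
rewrite {1}pencil_subZl [pencil Q _]pencilC oQ' ?sQ// mulr0 subr0.
rewrite pencilC pencil_subZl [pencil Q _]pencilC.
rewrite (@pencil_jacobi_low n Q) ?sQ// Qn /c.
transitivity (pencil (P n.+1) (P n.+1) -
  (e * e) * (h n.+1 ^+ 2 / pencil Q Q)); first by field.
by rewrite e2 mul1r.
Qed.

(** The hypothesis on [A] below n keeps the earlier pivots nonzero, so elimination never stops; the
    last pivot may vanish. *)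
Lemma exists_pencil_orthogonal n : pencil (P 0) (P 0) != 0 ->
  (forall k, (k < n)%N -> A k != 0) ->
  exists Q, pencil_orthogonal n Q /\ pencil Q Q = pencil_pivot n.
Proof.
move=> D0; elim: n => [_|n IH nA].
  have [mP sP oP] := P_orthogonal 0.
  exists (P 0); do ?split=> //.
  move=> q; rewrite leqn0 size_poly_eq0 => /eqP ->.
  by rewrite /pencil deriv0 !mulr0 L_0 !mulr0 subr0.
have [|Q [oQ QE]] := IH; first by move=> k kn; rewrite nA// ltnW.
have An0 := nA n (ltnSn n).
have piv0 : pencil_pivot n != 0.
  case: n nA {IH oQ QE} An0 => [//|n] nA An0 /=.
  rewrite !mulf_neq0 ?invr_eq0 ?oppr_eq0 ?nA// lt0r_neq0//.
    exact: jacobi_eigenvalue_gt0.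
  exact: h_gt0.
have [|Q' [oQ' Q'E]] := pencil_orthogonal_step oQ; first by rewrite QE.
by exists Q'; split=> //; rewrite Q'E QE pencil_pivot_rec.
Qed.

(** Splitting off the top term along [Q] writes the form as its value in lower degree plus a square
    times a pivot. *)
Lemma pencil_ge0 n p : pencil (P 0) (P 0) != 0 ->
  (forall k, (k < n)%N -> A k != 0) ->
  (forall k, (k <= n)%N -> 0 <= pencil_pivot k) ->
  (size p <= n.+1)%N -> 0 <= pencil p p.
Proof.
move=> D0 nA piv0.
suff H m : (m <= n.+1)%N -> forall p, (size p <= m)%N -> 0 <= pencil p p.
  exact: H.
elim: m => [_ {}p|m IH mn {}p sp].
  rewrite leqn0 size_poly_eq0 => /eqP ->.
  by rewrite /pencil deriv0 !mulr0 L_0 !mulr0 subr0.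
have [|Q [[mQ sQ oQ] QE]] := exists_pencil_orthogonal (n := m) D0.
  by move=> k km; rewrite nA// (leq_trans km).
have sq := size_sub_lead mQ sQ sp; set q := p - _ in sq.
have Qq : pencil Q q = 0 by exact: oQ.
have pq : pencil q q = pencil p q by rewrite {1}/q pencil_subZl Qq mulr0 subr0.
have pp : pencil p q = pencil p p - p`_m * pencil p Q.
  by rewrite pencilC /q pencil_subZl [pencil Q _]pencilC.
have pQ : pencil p Q = p`_m * pencil Q Q.
  by apply/eqP; rewrite -subr_eq0 -pencil_subZl pencilC Qq.
have -> : pencil p p = pencil q q + p`_m ^+ 2 * pencil Q Q.
  by rewrite pq pp pQ; ring.
by rewrite addr_ge0 ?IH ?(ltnW mn)// QE mulr_ge0 ?sqr_ge0// piv0.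
Qed.

End Jacobi.
End OrthogonalPolynomials.

(** * Smallest zeros of a sequence with a three term recurrence *)

Section Sturm.
Variable R : rcfType.

(** Left of all its roots [p] has its sign at minus infinity, which it has lost at [c]; the first
    root after minus the Cauchy bound is therefore the smallest one. *)
Lemma exists_first_root (p : {poly R}) c : sgp_minfty p * p.[c] < 0 ->
  exists2 mu, mu < c &
    root p mu /\ forall x, x < mu -> 0 < sgp_minfty p * p.[x].
Proof.
move=> pc; have p0 : p != 0.
  by apply: contraTneq pc => ->; rewrite horner0 mulr0 ltxx.
have pos x : {in `]-oo, x], forall z, ~~ root p z} -> 0 < sgp_minfty p * p.[x].
  move=> px; have <- : Num.sg p.[x] = sgp_minfty p.
    by apply: (sgp_minftyP px); rewrite in_itv/= lexx.
  rewrite -normrEsg normr_gt0 -rootE; apply: px.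
  by rewrite in_itv/= lexx.
pose d := - cauchy_bound p.
have noroot_d x : x <= d -> ~~ root p x.
  by move=> xd; apply: (le_cauchy_bound p0); rewrite in_itv.
have := next_rootP p d c; case => [pE|y _ py0 yI noroot_y|_ _ _ noroot_c].
- by rewrite pE eqxx in p0.
- exists y; first by case/andP: yI.
  split=> [|x xy]; first exact/rootP.
  apply: pos => z; rewrite in_itv/= => zx; have [/noroot_d//|dz] := leP z d.
  by apply: noroot_y; rewrite in_itv/= dz (le_lt_trans zx).
- suff /pos : {in `]-oo, c], forall z, ~~ root p z} by rewrite ltNge ltW.
  move=> z; rewrite in_itv/= => zc; have [/noroot_d//|dz] := leP z d.
  move: zc; rewrite le_eqVlt => /predU1P[->|zc]; last first.
    by apply: noroot_c; rewrite in_itv/= dz.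
  by apply: contraTN pc => /rootP ->; rewrite mulr0 ltxx.
Qed.

Variables (A : nat -> {poly R}) (B C : nat -> R) (c : R).
Hypothesis A_0 : A 0%N = 1.
Hypothesis A_1 : A 1%N = 'X + c%:P.
Hypothesis A_rec :
  forall k, A k.+2 = ('X + (B k)%:P) * A k.+1 - C k *: A k.
Hypothesis C_gt0 : forall k, 0 < C k.

Lemma size_monic_rec n : size (A n) = n.+1 /\ A n \is monic.
Proof.
suff [] : (size (A n) = n.+1 /\ A n \is monic) /\
  (size (A n.+1) = n.+2 /\ A n.+1 \is monic) by [].
elim: n => [|n [[sn mn] [sn1 mn1]]].
  by rewrite A_0 A_1 size_poly1 monic1 size_XaddC monicXaddC.
split=> //; rewrite A_rec.
have mX : 'X + (B n)%:P \is monic by exact: monicXaddC.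
have sM : size (('X + (B n)%:P) * A n.+1) = n.+3.
  by rewrite size_monicM ?monic_neq0// size_XaddC sn1.
have sC : (size (- (C n *: A n)) < size (('X + (B n)%:P) * A n.+1)%R)%N.
  rewrite size_polyN sM ltnS (leq_trans (size_scale_leq _ _))// sn//.
split; first by rewrite size_polyDl.
by rewrite monicE lead_coefDl// -monicE monicMl.
Qed.

Lemma sgp_minfty_rec n : sgp_minfty (A n) = (-1) ^+ n.
Proof.
have [sA /monicP mA] := size_monic_rec n.
by rewrite /sgp_minfty sA mA mulr1 /= sgrX sgrN1.
Qed.

(* The smallest zeros strictly decrease with n, because A_{n+2} and A_n have
   opposite signs at the smallest zero of A_{n+1}. *)
Lemma smallest_zero_rec n : exists mu,
  [/\ root (A n.+1) mu,
      forall x j, x < mu -> (j <= n.+1)%N -> 0 < (-1) ^+ j * (A j).[x] &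
      forall j, (j <= n)%N -> 0 < (-1) ^+ j * (A j).[mu]].
Proof.
elim: n => [|n [mu [rmu ltmu atmu]]].
  exists (- c); split.
  - by rewrite A_1 /root !hornerE addNr.
  - move=> x [|[|//]] xc _; first by rewrite A_0 expr0 mul1r hornerC.
    by rewrite A_1 !hornerE expr1; lra.
  - by case=> // _; rewrite A_0 expr0 mul1r hornerC.
have neg : sgp_minfty (A n.+2) * (A n.+2).[mu] < 0.
  rewrite sgp_minfty_rec A_rec hornerD hornerM (rootP rmu) mulr0 add0r.
  rewrite hornerN hornerZ mulrN oppr_lt0 !exprS !mulN1r opprK mulrCA.
  by rewrite mulr_gt0// atmu.
have [nu numu [rnu ltnu]] := exists_first_root neg.
exists nu; split=> // [x j xnu|j jn]; last exact: ltmu.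
rewrite leq_eqVlt => /predU1P[->|]; first by rewrite -sgp_minfty_rec ltnu.
by rewrite ltnS => jn; apply: ltmu => //; exact: lt_trans numu.
Qed.

End Sturm.

(** * The Jacobi case *)

Section Assembly.
Variables (R : realType) (alpha beta xi : R).
Hypotheses (a0 : 0 < alpha) (b0 : 0 < beta) (xi1 : 1 < `|xi|).
Implicit Types (p q : {poly R}).

Local Notation L :=
  (weight_functional (jacobi_weight (alpha - 1) (beta - 1))).
Local Notation P := (jacobi (alpha - 1) (beta - 1)).
Local Notation e := (eps xi).

Let L_linear := jacobi_functional_linear a0 b0.
Let L_gt0 := jacobi_functional_gt0 a0 b0.
Let L_pearson := jacobi_functional_pearson a0 b0.

Lemma jacobi_monic_orthogonal k : monic_orthogonal L k (P k).
Proof. exact: xgetPex (exists_monic_orthogonal L_linear L_gt0 k). Qed.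

Let P_orthogonal := jacobi_monic_orthogonal.
Let P_coef1E := P_coef1 L_linear L_gt0 a0 b0 L_pearson P_orthogonal.
Let P_coef2E := P_coef2 L_linear L_gt0 a0 b0 L_pearson P_orthogonal.

Lemma eps_sign : e = 1 \/ e = -1.
Proof. by rewrite /eps; case: ifP; [left|right]. Qed.

Lemma eps_sqr : e * e = 1.
Proof. by case: eps_sign => ->; rewrite ?mulrNN mulr1. Qed.

(** As [xi] lies outside [-1, 1], [x - xi] has a constant sign. *)
Lemma eps_norm x : -1 < x < 1 -> e * (x - xi) = `|x - xi|.
Proof.
move=> x1; rewrite /eps; case: ltP => xi0.
  by rewrite mul1r ger0_norm//; lra.
have : 1 < xi by move: xi1; rewrite ltr_normr; lra.
by move=> xi2; rewrite mulN1r ler0_norm//; lra.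
Qed.

Lemma c0E p : c0 alpha beta xi p = e * L (('X - xi%:P) * p).
Proof.
rewrite -(L_Z L_linear); apply: eq_Rintegral => x.
rewrite inE/= in_itv/= => x1; rewrite -eps_norm// hornerZ hornerM hornerXsubC.
by ring.
Qed.

Lemma c1E p : c1 alpha beta p = L ((1 - 'X^2) * p).
Proof.
apply: eq_Rintegral => x; rewrite inE/= in_itv/= => x1.
rewrite jacobi_weightD1// hornerM !(hornerD, hornerN, hornerC, hornerXn).
by ring.
Qed.

Lemma c1_ge0 p : 0 <= c1 alpha beta (p ^+ 2).
Proof.
apply: Rintegral_ge0 => x; rewrite /= in_itv/= => x1.
by rewrite mulr_ge0 ?horner_exp ?sqr_ge0 ?ltW ?jacobi_weight_gt0.
Qed.

Lemma c0_gt0 p : p != 0 -> 0 < c0 alpha beta xi (p ^+ 2).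
Proof.
move=> p0; rewrite c0E -(L_Z L_linear); apply: L_gt0 => [|x x1].
  rewrite scaler_eq0 negb_or mulf_neq0 ?polyXsubC_eq0 ?expf_neq0// andbT.
  by case: eps_sign => ->; rewrite ?oppr_eq0 oner_eq0.
have -> : (e *: (('X - xi%:P) * p ^+ 2)).[x] = `|x - xi| * p.[x] ^+ 2.
  by rewrite -eps_norm// hornerZ hornerM hornerXsubC horner_exp; ring.
by rewrite mulr_ge0 ?sqr_ge0.
Qed.

Lemma pencilE lam p : pencil L xi e lam p p =
  c0 alpha beta xi (p ^+ 2) - lam * c1 alpha beta (p^`() ^+ 2).
Proof. by rewrite /pencil c0E c1E -!expr2. Qed.

(** * Explicit forms of $A_1$ *)

Lemma horner_jacobi1 : (P 1).[xi] = xi + (P 1)`_0.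
Proof.
rewrite horner_coef (size_P P_orthogonal) !big_ord_recr big_ord0/=.
by rewrite (P_lead P_orthogonal 1); ring.
Qed.

Lemma horner_jacobi2 : (P 2).[xi] = xi ^+ 2 + (P 2)`_1 * xi + (P 2)`_0.
Proof.
rewrite horner_coef (size_P P_orthogonal) !big_ord_recr big_ord0/=.
by rewrite (P_lead P_orthogonal 2); ring.
Qed.

Let P10 : (P 1)`_0 = - (beta - alpha) / (alpha + beta).
Proof. by rewrite P_coef1E mulr0 !add0r mulr1. Qed.

Let P21 : (P 2)`_1 = - (beta - alpha) * 2 / (2 + alpha + beta).
Proof. by rewrite P_coef1E mulr1. Qed.

Let P20 :
  (P 2)`_0 = - ((beta - alpha) * (P 2)`_1 + 2) / (2 * (1 + alpha + beta)).
Proof. by rewrite P_coef2E mulr0 !add0r !mulr1. Qed.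

(** The expression vanishes only at the zero of $P_1$, which lies in ]-1, 1[. *)
Lemma jacobi1_denominator_neq0 : xi * (alpha + beta) - beta + alpha != 0.
Proof.
have s0 : 0 < alpha + beta by move: (a0) (b0); lra.
apply/eqP => H; have xiE : xi = (beta - alpha) / (alpha + beta).
  by apply: (mulIf (lt0r_neq0 s0)); rewrite divfK ?lt0r_neq0//; lra.
move: xi1; rewrite xiE normrM normfV (gtr0_norm s0) ltr_pdivlMr// mul1r.
by rewrite ltr_normr; move: (a0) (b0); lra.
Qed.

Lemma horner_polyA1 lam : (polyA alpha beta xi 1).[lam] =
  lam + e / (alpha + beta) * ((P 2).[xi] / (P 1).[xi]).
Proof. by rewrite /= !hornerE. Qed.

Lemma horner_polyA1_expand lam : (polyA alpha beta xi 1).[lam] =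
  lam + e / (alpha + beta) *
    (xi - (beta - alpha) * (alpha + beta - 2) /
          ((2 + alpha + beta) * (alpha + beta))
        - 4 * alpha * beta /
          (pochhammer (alpha + beta) 2 *
           (xi * (alpha + beta) - beta + alpha))).
Proof.
rewrite horner_polyA1 horner_jacobi1 horner_jacobi2 P20 P21 P10.
rewrite /pochhammer !big_ord_recr big_ord0/= mul1r addr0.
have := jacobi1_denominator_neq0; move: (a0) (b0) => a1 b1 d0.
field; rewrite d0.
by do ?[apply/andP; split]; rewrite // lt0r_neq0//; lra.
Qed.

Lemma horner_polyA1_ratio lam : (polyA alpha beta xi 1).[lam] =
  lam + e *
    ((pochhammer (1 + alpha + beta) 2 * xi ^+ 2
      + 2 * (alpha - beta) * (1 + alpha + beta) * xi
      + (alpha - beta) ^+ 2 - (2 + alpha + beta)) /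
     (pochhammer (1 + alpha + beta) 2 *
      (xi * (alpha + beta) - beta + alpha))).
Proof.
rewrite horner_polyA1 horner_jacobi1 horner_jacobi2 P20 P21 P10.
rewrite /pochhammer !big_ord_recr big_ord0/= mul1r addr0.
have := jacobi1_denominator_neq0; move: (a0) (b0) => a1 b1 d0.
field; rewrite d0.
by do ?[apply/andP; split]; rewrite // lt0r_neq0//; lra.
Qed.

(** $P_0$ is constant, so only the positive definite part $c_0$ contributes. *)
Lemma pencil_jacobi0_gt0 lam : 0 < pencil L xi e lam (P 0) (P 0).
Proof.
have [mP sP _] := P_orthogonal 0.
have P'0 : (P 0)^`() = 0 by rewrite (size1_polyC (eq_leq sP)) derivC.
rewrite pencilE P'0 c1E expr0n/= mulr0 (L_0 L_linear) mulr0 subr0.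
by rewrite c0_gt0 ?monic_neq0.
Qed.

(** * Matching $A_n$ with the pencil, and conclusion *)

Local Notation ev := (jacobi_eigenvalue alpha beta).
Local Notation h k := (L (P k ^+ 2)).

(** The three term recurrence at [xi] expands $P_2(\xi)/P_1(\xi)$, and the pencil at $P_0$ equals
    $-\varepsilon P_1(\xi) h_0$. *)
Lemma polyA1_pencil lam : (polyA alpha beta xi 1).[lam] =
  lam + e / ev 1 * (xi - rec_b P 1) +
  h 1 / (ev 1 * pencil L xi e lam (P 0) (P 0)).
Proof.
have := pencil_jacobi0_gt0 lam; rewrite horner_polyA1.
rewrite (h_rec L_linear P_orthogonal).
rewrite (pencil_jacobi_diag L_linear L_gt0 L_pearson P_orthogonal).
rewrite /rec_c /rec_b horner_jacobi1 horner_jacobi2 /jacobi_eigenvalue.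
rewrite !(mul0r, mulr0, sub0r, subr0).
have h0 := h_gt0 L_gt0 P_orthogonal 0; move/lt0r_neq0.
rewrite !mulf_eq0 !negb_or -andbA => /and3P[e0 d0 _].
have d1 : xi + (P 1)`_0 != 0 by rewrite addrC -oppr_eq0 opprD.
have s1 : 1 + alpha + beta - 1 != 0 by apply: lt0r_neq0; move: (a0) (b0); lra.
have {}h0 := lt0r_neq0 h0.
by case: eps_sign => ->; field; rewrite h0 d0 s1 d1.
Qed.

Lemma coefBE k : Defs.coefB alpha beta xi k.+1 =
  e / ev k.+1 * (xi - rec_b P k.+1).
Proof. by rewrite (rec_bE L_linear L_gt0 a0 b0 L_pearson P_orthogonal). Qed.

Lemma coefCE k : Defs.coefC alpha beta k.+2 =
  h k.+2 / (h k.+1 * ev k.+2 * ev k.+1).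
Proof.
rewrite (h_rec L_linear P_orthogonal k.+1).
rewrite (rec_cE L_linear L_gt0 a0 b0 L_pearson P_orthogonal).
have h0 := lt0r_neq0 (h_gt0 L_gt0 P_orthogonal k.+1).
move: (h k.+1) h0 => t t0.
rewrite /Defs.coefC /jacobi_eigenvalue -[k.+2%:R]natr1 -[k.+1%:R]natr1.
have k0 : 0 <= k%:R :> R by exact: ler0n.
move: k%:R k0 => n n0; move: (a0) (b0) => a1 b1.
field; rewrite t0.
by do ?[apply/andP; split]; rewrite // lt0r_neq0//; lra.
Qed.

Lemma coefC_gt0 k : 0 < Defs.coefC alpha beta k.+2.
Proof.
have h0 := h_gt0 L_gt0 P_orthogonal; have ev0 := jacobi_eigenvalue_gt0 a0 b0.
rewrite coefCE.
exact: divr_gt0 (h0 _) (mulr_gt0 (mulr_gt0 (h0 _) (ev0 _)) (ev0 _)).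
Qed.

Lemma horner_polyA_rec lam k : (polyA alpha beta xi k.+2).[lam] =
  (lam + e / ev k.+2 * (xi - rec_b P k.+2)) * (polyA alpha beta xi k.+1).[lam]
  - h k.+2 / (h k.+1 * ev k.+2 * ev k.+1) * (polyA alpha beta xi k).[lam].
Proof.
rewrite -coefBE -coefCE.
have -> : polyA alpha beta xi k.+2 =
  ('X + (Defs.coefB alpha beta xi k.+2)%:P) * polyA alpha beta xi k.+1 -
  Defs.coefC alpha beta k.+2 *: polyA alpha beta xi k by [].
by rewrite hornerD hornerN hornerZ hornerM hornerD hornerX hornerC.
Qed.

Lemma exists_smallest_zero_polyA n : exists mu : R,
  is_smallest_zero (polyA alpha beta xi n.+1) mu /\
  forall p, (size p <= n.+2)%N ->
    c1 alpha beta (p^`() ^+ 2) <= 1 / mu * c0 alpha beta xi (p ^+ 2).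
Proof.
have [] := @smallest_zero_rec R (polyA alpha beta xi)
  (fun k => Defs.coefB alpha beta xi k.+2) (fun k => Defs.coefC alpha beta k.+2)
  (e / (alpha + beta) * ((P 2).[xi] / (P 1).[xi])) erefl erefl
  (fun=> erefl) coefC_gt0 n.
move=> mu [rmu ltmu atmu].
pose A k := (polyA alpha beta xi k).[mu].
have D0 := pencil_jacobi0_gt0 mu.
have A0 : A 0 = 1 by rewrite /A/= hornerC.
have An k : (k < n.+1)%N -> A k != 0.
  by move/atmu; apply: contraTneq; rewrite -/(A k) => ->; rewrite mulr0 ltxx.
have pivot_n : pencil_pivot L alpha beta P xi e mu A n.+1 = 0.
  by rewrite /= /A (rootP rmu) mulr0 mul0r.
have pivot_ge0 k : (k <= n.+1)%N ->
    0 <= pencil_pivot L alpha beta P xi e mu A k.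
  rewrite leq_eqVlt => /predU1P[->|kn]; first by rewrite pivot_n.
  case: k kn => [_|k kn]; first exact: ltW.
  (* The minus sign of the pivot is absorbed by the alternating signs that make the values of [A]
     positive at [mu]. *)
  rewrite /= (_ : _ / _ = ev k.+1 * h k.+1 *
    (((-1) ^+ k.+1 * A k.+1) / ((-1) ^+ k * A k))); last first.
    rewrite [(-1) ^+ k.+1]exprS; have := lt0r_neq0 (atmu k (ltnW kn)).
    rewrite mulf_eq0 negb_or.
    by case/andP=> s0 Ak0; field; rewrite s0 Ak0.
  have h0 := h_gt0 L_gt0 P_orthogonal k.+1.
  have ev0 := jacobi_eigenvalue_gt0 a0 b0 k.
  apply/ltW/mulr_gt0; first exact: mulr_gt0 ev0 h0.
  exact: divr_gt0 (atmu k.+1 kn) (atmu k (ltnW kn)).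
have [Q [[mQ sQ oQ] QE]] := exists_pencil_orthogonal L_linear L_gt0 a0 b0
  L_pearson P_orthogonal eps_sqr A0 (polyA1_pencil mu) (horner_polyA_rec mu)
  (lt0r_neq0 D0) An.
(* The last pivot is 0, so $c_0(Q^2) = \mu\, c_1(Q'^2)$; the left side is positive and $c_1(Q'^2)
   \ge 0$. *)
have mu0 : 0 < mu.
  have := c0_gt0 (monic_neq0 mQ); have := c1_ge0 Q^`().
  move: QE; rewrite pivot_n pencilE => /eqP; rewrite subr_eq0 => /eqP ->.
  by move=> c1Q; apply: contraTT; rewrite -!leNgt => mu0; exact: mulr_le0_ge0.
exists mu; split.
  split=> // nu rnu; rewrite leNgt; apply/negP => /ltmu/(_ (leqnn _)).
  by rewrite (rootP rnu) mulr0 ltxx.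
move=> p sp; rewrite mul1r mulrC ler_pdivlMr// mulrC -subr_ge0 -pencilE.
exact: (pencil_ge0 L_linear L_gt0 a0 b0 L_pearson P_orthogonal eps_sqr A0
  (polyA1_pencil mu) (horner_polyA_rec mu) (lt0r_neq0 D0) An pivot_ge0 sp).
Qed.

End Assembly.

Theorem theorem3p2 (R : realType) (alpha beta xi : R)
    (halpha : 0 < alpha) (hbeta : 0 < beta) (hxi : 1 < `|xi|) :
  (forall lambda : R,
     (polyA alpha beta xi 1).[lambda] =
     lambda + eps xi / (alpha + beta) *
       (xi - (beta - alpha) * (alpha + beta - 2) /
             ((2 + alpha + beta) * (alpha + beta))
           - 4 * alpha * beta /
             (pochhammer (alpha + beta) 2 *
              (xi * (alpha + beta) - beta + alpha))))
  /\
  (forall lambda : R,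
     (polyA alpha beta xi 1).[lambda] =
     lambda + eps xi *
       ((pochhammer (1 + alpha + beta) 2 * xi ^+ 2
         + 2 * (alpha - beta) * (1 + alpha + beta) * xi
         + (alpha - beta) ^+ 2 - (2 + alpha + beta)) /
        (pochhammer (1 + alpha + beta) 2 *
         (xi * (alpha + beta) - beta + alpha))))
  /\
  (forall n : nat, (1 <= n)%N ->
     exists mu : R,
       is_smallest_zero (polyA alpha beta xi n) mu /\
       forall p : {poly R}, (size p <= n.+1)%N ->
         c1 alpha beta (p^`() ^+ 2) <= 1 / mu * c0 alpha beta xi (p ^+ 2)).
Proof.
split; first exact: horner_polyA1_expand.
split; first exact: horner_polyA1_ratio.
case=> // n _; exact: exists_smallest_zero_polyA.
Qed.
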